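(* Let $f:[a,b]\to\mathbb{R}$ be a convex function, and let $N\ge 1$ and $n_1\ge 1$ be integers. Let $\mathbf{p}_1=(p_{1,1},\dots,p_{n_1,1})$ satisfy $p_{i,1}\ge 0$ for $i=1,\dots,n_1$ and $\sum_{i=1}^{n_1}p_{i,1}=1$, and let $\mathbf{x}_1=(x_{1,1},\dots,x_{n_1,1})\in[a,b]^{n_1}$. Let $n_k$, $\mathbf{q}_k=(q_{1,k},\dots,q_{n_k,k})$, $\mathbf{x}_k=(x_{1,k},\dots,x_{n_k,k})$, $p_{i,k}$ and $m_k$, $k=1,\dots,N$, be as in the recursion described in the context, where for each $k=1,\dots,N$ the tuple $\mathbf{q}_k$ is a given $n_k$-tuple with $q_{i,k}>0$ for $i=1,\dots,n_k$ and $\sum_{i=1}^{n_k}q_{i,k}=1$ (so that $n_1\ge n_2\ge\dots\ge n_N$). Then $$J_{n_1}(f,\mathbf{x}_1,\mathbf{p}_1)-\sum_{k=1}^N m_k\,J_{n_k}(f,\mathbf{x}_k,\mathbf{q}_k)\ \ge\ 0 .$$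
   Context: Jensen functional: for a function $f$ on an interval, an $n$-tuple $\mathbf{x}=(x_1,\dots,x_n)$ of points of the interval and a weight $n$-tuple $\mathbf{p}=(p_1,\dots,p_n)$ with $\sum_i p_i=1$, $$J_n(f,\mathbf{x},\mathbf{p})=\sum_{i=1}^n p_i f(x_i)-f\Big(\sum_{i=1}^n p_i x_i\Big).$$ Recursion (all indices with vanishing new weight are eliminated, and one single new entry is added). The tuples $\mathbf{q}_k$ are arbitrary given positive weight tuples of length $n_k$ with sum $1$; they are not constructed. For $k=1,\dots,N$ put $$m_k=\min_{1\le i\le n_k}\frac{p_{i,k}}{q_{i,k}}.$$ For $k=2,\dots,N$ let $j_1<j_2<\dots<j_{n_k-1}$ be the list of those indices $j\in\{1,\dots,n_{k-1}\}$ for which $\frac{p_{j,k-1}}{q_{j,k-1}}\ne m_{k-1}$ (this defines $n_k$: it is one plus the number of such indices; the list may be empty, in which case $n_k=1$), and define $$p_{i,k}=p_{j_i,k-1}-m_{k-1}q_{j_i,k-1},\qquad x_{i,k}=x_{j_i,k-1},\qquad i=1,\dots,n_k-1,$$ $$p_{n_k,k}=m_{k-1},\qquad x_{n_k,k}=\sum_{l=1}^{n_{k-1}}q_{l,k-1}x_{l,k-1}.$$ *)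

(* Defs.v *)
From HB Require Import structures.
From mathcomp Require Import all_boot all_order all_algebra.
From mathcomp Require Import all_classical all_reals all_analysis.

Set Implicit Arguments.
Unset Strict Implicit.
Unset Printing Implicit Defensive.

Import Order.TTheory GRing.Theory Num.Theory.

Local Open Scope ring_scope.

Definition jensen (R : realType) (n : nat) (f : R -> R) (x p : n.-tuple R) : R :=
  \sum_(i < n) tnth p i * f (tnth x i) - f (\sum_(i < n) tnth p i * tnth x i).

Definition ratios (R : realType) (n : nat) (p q : n.-tuple R) : n.-tuple R :=
  [tuple tnth p i / tnth q i | i < n].

(* The neutral value of the iterated minimum is the first ratio, so for n >= 1
   this is the least ratio; for n = 0 it is 0. *)
Definition min_ratio (R : realType) (n : nat) (p q : n.-tuple R) : R :=
  \big[Num.min/head 0 (ratios p q)]_(i < n) tnth (ratios p q) i.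

(* [enum 'I_n] is increasing, so this is the list j_1 < j_2 < ... *)
Definition kept (R : realType) (n : nat) (p q : n.-tuple R) : seq 'I_n :=
  [seq j <- enum 'I_n | tnth (ratios p q) j != min_ratio p q].

(* The equalities are between sequences, hence they also force n' to be one
   plus the number of kept indices. *)
Definition jensen_step (R : realType) (n n' : nat) (p q x : n.-tuple R)
    (p' x' : n'.-tuple R) : Prop :=
  (p' = rcons [seq tnth p j - min_ratio p q * tnth q j | j <- kept p q]
              (min_ratio p q) :> seq R)
  /\
  (x' = rcons [seq tnth x j | j <- kept p q]
              (\sum_(l < n) tnth q l * tnth x l) :> seq R).

(* Main.v *)
Require Import Defs.
From mathcomp Require Import all_boot all_order all_algebra.
From mathcomp Require Import all_classical all_reals all_analysis.
From mathcomp Require Import ring lra.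

Set Implicit Arguments.
Unset Strict Implicit.
Unset Printing Implicit Defensive.

Import Order.TTheory GRing.Theory Num.Theory.
Local Open Scope ring_scope.

(** One step of the recursion takes a fraction [m] of the mass, distributed
    according to [q], and puts it at the barycentre of [x] under [q], the
    indices left without mass being dropped.  Sums of the form
    [\sum p_i g(x_i)] therefore decrease by [m] times the Jensen gap of [g] at
    [x] and [q] ([jensen_step_sum]).  With [g] the identity the gap is zero, so the
    barycentre of [p] is fixed; hence with [g = f] the step turns the Jensen
    functional [J(x, p)] into exactly [J(x, p) - m J(x, q)] ([jensen_stepE]).

    The new weights have sum [1], and they are nonnegative because [m] is the
    smallest ratio [p_i / q_i]; the new point, a barycentre, stays in the
    segment ([admissible_step]).  The differences telescope: the left-hand side of the
    inequality is the Jensen functional of the tuples that one further step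
    produces after the [N]-th ones, and this is nonnegative by Jensen's
    inequality ([jensen_ge0]). *)

(** The triples (mass, moment, value) lying above the perspective of [f], that
    is [w * f (s / w) <= v] when [0 < w].  The point [z] replaces the quotient [s / w] so
    that zero masses need no separate treatment: they force [s = 0] and
    [0 <= v]. *)
Definition perspective_cone (R : realType) (a b : R) (f : R -> R) (w s v : R) :=
  0 <= w /\ exists z, [/\ z \in `[a, b], s = w * z & w * f z <= v].

(** Convexity of [f] in homogeneous form.  Closure under addition makes
    Jensen's inequality an induction on the number of points in which the
    partial sums of the weights need not be renormalised, and may vanish. *)
Lemma perspective_coneD (R : realType) (a b : R) (f : R -> R)
    (f_convex : convex_function (`[a, b]%classic : set R^o) f)
    (w1 s1 v1 w2 s2 v2 : R) :
  perspective_cone a b f w1 s1 v1 -> perspective_cone a b f w2 s2 v2 ->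
  perspective_cone a b f (w1 + w2) (s1 + s2) (v1 + v2).
Proof.
move=> [w1_ge0 [z1 [z1_in -> le_v1]]] [w2_ge0 [z2 [z2_in -> le_v2]]].
split; first exact: addr_ge0.
have [w0|w_neq0] := eqVneq (w1 + w2) 0.
  (* Both masses vanish, and any point of the segment is a witness. *)
  have [w10 w20] : w1 = 0 /\ w2 = 0 by split; lra.
  by exists z1; split=> //; subst; lra.
have w_gt0 : 0 < w1 + w2 by rewrite lt_neqAle eq_sym w_neq0 addr_ge0.
have t_ge0 : 0 <= w1 / (w1 + w2) by rewrite divr_ge0 // ltW.
have t_le1 : w1 / (w1 + w2) <= 1 by rewrite ler_pdivrMr // mul1r lerDl.
have tE : (w1 + w2) * (w1 / (w1 + w2)) = w1 by rewrite mulrC divfK.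
move: (w1 / (w1 + w2)) t_ge0 t_le1 tE => t t_ge0 t_le1 tE.
have f_le : f (t * z1 + (1 - t) * z2) <= t * f z1 + (1 - t) * f z2.
  by apply: (f_convex (Itv01 t_ge0 t_le1)); rewrite inE.
have onemE : (w1 + w2) * (1 - t) = w2 by rewrite mulrBr mulr1 tE addrAC subrr add0r.
exists (t * z1 + (1 - t) * z2); split.
- move: z1_in z2_in; rewrite !in_itv /= => /andP[le_az1 le_z1b] /andP[le_az2 le_z2b].
  by clear - t_ge0 t_le1 le_az1 le_z1b le_az2 le_z2b; apply/andP; split; nra.
- by rewrite mulrDr !mulrA tE onemE.
- apply: le_trans (lerD le_v1 le_v2).
  apply: le_trans (ler_wpM2l (ltW w_gt0) f_le) _.
  by rewrite mulrDr !mulrA tE onemE.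
Qed.

Definition admissible (R : realType) (a b : R) (n : nat) (p x : n.-tuple R) :=
  [/\ forall i, 0 <= tnth p i, \sum_(i < n) tnth p i = 1
    & forall i, tnth x i \in `[a, b]].

Lemma jensen_ge0 (R : realType) (a b : R) (f : R -> R)
    (f_convex : convex_function (`[a, b]%classic : set R^o) f)
    (n : nat) (p x : n.-tuple R) :
  admissible a b p x -> 0 <= jensen f x p.
Proof.
move=> [p_ge0 p_sum x_in].
(* The empty sum still needs a point of the segment as a witness. *)
have [i0] : exists i0 : 'I_n, True.
  case: n p x p_sum {p_ge0 x_in} => [|n] p x p_sum; last by exists ord0.
  by move/eqP: p_sum; rewrite big_ord0 eq_sym oner_eq0.
have [_ [z [_]]] : perspective_cone a b f (\sum_(i < n) tnth p i)
    (\sum_(i < n) tnth p i * tnth x i) (\sum_(i < n) tnth p i * f (tnth x i)).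
  elim/big_rec3: _ => [|i v s w _ cone_wsv].
    by split=> //; exists (tnth x i0); split; rewrite ?mul0r.
  by apply: perspective_coneD => //; split=> //; exists (tnth x i).
by rewrite p_sum !mul1r /jensen => -> ?; rewrite subr_ge0.
Qed.

Lemma min_ratio_ge0 (R : realType) (n : nat) (p q : n.-tuple R) :
  (forall i, 0 <= tnth p i) -> (forall i, 0 < tnth q i) -> 0 <= min_ratio p q.
Proof.
move=> p_ge0 q_gt0.
have ratio_ge0 i : 0 <= tnth (ratios p q) i.
  by rewrite tnth_mktuple divr_ge0 // ltW.
apply: le_bigmin => //.
case: n p q {p_ge0 q_gt0} ratio_ge0 => [|n] p q ratio_ge0.
  by rewrite [ratios p q]tuple0.
by rewrite -nth0 -(tnth_nth 0 _ ord0).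
Qed.

Lemma min_ratio_le (R : realType) (n : nat) (p q : n.-tuple R) (i : 'I_n) :
  0 < tnth q i -> min_ratio p q * tnth q i <= tnth p i.
Proof.
move=> q_gt0; rewrite -ler_pdivlMr //.
by apply: le_trans (bigmin_le _ i _) _; rewrite tnth_mktuple.
Qed.

(** The indices that the step drops are those with [p_i - m q_i = 0], so the sum
    over the kept ones equals the sum over all of them. *)
Lemma jensen_step_sum (R : realType) (n n' : nat) (p q x : n.-tuple R)
    (p' x' : n'.-tuple R) (g : R -> R) :
  (forall i, 0 < tnth q i) -> jensen_step p q x p' x' ->
  \sum_(i < n') tnth p' i * g (tnth x' i)
    = \sum_(i < n) tnth p i * g (tnth x i)
      - min_ratio p q * \sum_(i < n) tnth q i * g (tnth x i)
      + min_ratio p q * g (\sum_(i < n) tnth q i * tnth x i).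
Proof.
move=> q_gt0 [p'E x'E].
transitivity (\sum_(u <- zip p' x') u.1 * g u.2).
  rewrite (big_nth (0, 0)) size_zip !size_tuple minnn big_mkord.
  by apply: eq_bigr => i _; rewrite nth_zip ?size_tuple //= -!tnth_nth.
rewrite p'E x'E zip_rcons ?size_map // zip_map big_rcons /= big_map /=.
congr (_ + _).
rewrite /kept big_filter big_enum_cond /= mulr_sumr -sumrB big_mkcond /=.
apply: eq_bigr => i _; rewrite mulrA -mulrBl; case: eqP => //= ratioE.
by rewrite -ratioE tnth_mktuple divfK ?gt_eqF // subrr mul0r.
Qed.

Lemma jensen_step_bary (R : realType) (n n' : nat) (p q x : n.-tuple R)
    (p' x' : n'.-tuple R) :
  (forall i, 0 < tnth q i) -> jensen_step p q x p' x' ->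
  \sum_(i < n') tnth p' i * tnth x' i = \sum_(i < n) tnth p i * tnth x i.
Proof. by move=> q_gt0 /(jensen_step_sum id q_gt0) /= ->; rewrite subrK. Qed.

Lemma jensen_stepE (R : realType) (f : R -> R) (n n' : nat) (p q x : n.-tuple R)
    (p' x' : n'.-tuple R) :
  (forall i, 0 < tnth q i) -> jensen_step p q x p' x' ->
  jensen f x' p' = jensen f x p - min_ratio p q * jensen f x q.
Proof.
move=> q_gt0 st; rewrite /jensen (jensen_step_bary q_gt0 st).
by rewrite (jensen_step_sum f q_gt0 st); ring.
Qed.

Lemma admissible_step (R : realType) (a b : R) (n n' : nat)
    (p q x : n.-tuple R) (p' x' : n'.-tuple R) :
  admissible a b p x -> (forall i, 0 < tnth q i) -> \sum_(i < n) tnth q i = 1 ->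
  jensen_step p q x p' x' -> admissible a b p' x'.
Proof.
move=> [p_ge0 p_sum x_in] q_gt0 q_sum st; have [p'E x'E] := st.
split.
- move=> i; have := mem_tnth i p'; rewrite memtE p'E mem_rcons inE.
  case/predU1P => [->|/mapP[j _ ->]]; first exact: min_ratio_ge0.
  by rewrite subr_ge0 min_ratio_le.
(* For the constant function 1 the Jensen gap is zero. *)
- have := jensen_step_sum (fun=> 1) q_gt0 st.
  by rewrite -!mulr_suml !mulr1 p_sum q_sum mulr1 subrK.
- move=> i; have := mem_tnth i x'; rewrite memtE x'E mem_rcons inE.
  case/predU1P => [->|/mapP[j _ ->] //].
  rewrite in_itv /= -[a]mul1r -[b]mul1r -q_sum !mulr_suml.
  by apply/andP; split; apply: ler_sum => j _; rewrite ler_pM2l //;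
    have := x_in j; rewrite in_itv /= => /andP[].
Qed.

(** Supplies the step after the last given tuples, whose Jensen functional is
    what remains once all the terms have been subtracted. *)
Lemma jensen_step_exists (R : realType) (n : nat) (p q x : n.-tuple R) :
  exists n' (p' x' : n'.-tuple R), jensen_step p q x p' x'.
Proof.
pose m := min_ratio p q.
exists (size (kept p q)).+1.
exists [tuple of rcons (map_tuple (fun j => tnth p j - m * tnth q j)
                                  (in_tuple (kept p q))) m].
by exists [tuple of rcons (map_tuple (tnth x) (in_tuple (kept p q)))
                          (\sum_(l < n) tnth q l * tnth x l)].
Qed.

Theorem theorem8 (R : realType) (a b : R) (f : R -> R) (N : nat)
    (n : nat -> nat) (p q x : forall k : nat, (n k).-tuple R)
    (f_convex : convex_function (`[a, b]%classic : set R^o) f)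
    (N_ge1 : (1 <= N)%N) (n1_ge1 : (1 <= n 1)%N)
    (p1_ge0 : forall i : 'I_(n 1%N), 0 <= tnth (p 1%N) i)
    (p1_sum : \sum_(i < n 1%N) tnth (p 1%N) i = 1)
    (x1_in : forall i : 'I_(n 1%N), tnth (x 1%N) i \in `[a, b])
    (q_gt0 : forall k : nat, (1 <= k <= N)%N ->
       forall i : 'I_(n k), 0 < tnth (q k) i)
    (q_sum : forall k : nat, (1 <= k <= N)%N ->
       \sum_(i < n k) tnth (q k) i = 1)
    (step : forall k : nat, (2 <= k <= N)%N ->
       jensen_step (p k.-1) (q k.-1) (x k.-1) (p k) (x k)) :
  jensen f (x 1%N) (p 1%N)
    - \sum_(1 <= k < N.+1) min_ratio (p k) (q k) * jensen f (x k) (q k) >= 0.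
Proof.
have telescope k : (k < N)%N -> admissible a b (p k.+1) (x k.+1) /\
    jensen f (x 1%N) (p 1%N)
      - \sum_(1 <= j < k.+1) min_ratio (p j) (q j) * jensen f (x j) (q j)
    = jensen f (x k.+1) (p k.+1).
  elim: k => [|k IHk] lt_kN; first by rewrite big_nil subr0.
  have [adm jensenE] := IHk (ltnW lt_kN).
  have k_in : (1 <= k.+1 <= N)%N := ltnW lt_kN.
  have st : jensen_step (p k.+1) (q k.+1) (x k.+1) (p k.+2) (x k.+2) := step k.+2 lt_kN.
  split.
    exact: admissible_step adm (q_gt0 _ k_in) (q_sum _ k_in) st.
  rewrite big_nat_recr //= opprD addrA jensenE.
  by rewrite (jensen_stepE f (q_gt0 _ k_in) st).
case: N N_ge1 q_gt0 q_sum telescope {step} => // N _ q_gt0 q_sum telescope.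
have N_in : (1 <= N.+1 <= N.+1)%N by rewrite leqnn.
have [adm jensenE] := telescope N (leqnn _).
have [n' [p' [x' st]]] := jensen_step_exists (p N.+1) (q N.+1) (x N.+1).
rewrite big_nat_recr //= opprD addrA jensenE -(jensen_stepE f (q_gt0 _ N_in) st).
apply: (jensen_ge0 f_convex).
exact: admissible_step adm (q_gt0 _ N_in) (q_sum _ N_in) st.
Qed.
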